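(* Let $\mathcal{R}\subset\mathcal{O}=\mathbb{F}_q[[z]]$ be any unibranch singularity ring (not necessarily Gorenstein or planar). Then $$\mathcal{H}^{mot}(q,t,a)=\sum_{M} t^{\deg(M)}\prod_{i=1}^{rk_q(M)-1}(1+q^i a),$$ where the sum is over all standard modules $M\subset\mathcal{O}$ and $\prod_{i=1}^{0}=1$.
   Context: Let $\mathbb{F}_q$ be the field with $q$ elements, $\mathcal{O}=\mathbb{F}_q[[z]]$, and $\nu_z$ the $z$-adic valuation. A unibranch singularity ring is an $\mathbb{F}_q$-subalgebra $\mathcal{R}\subset\mathcal{O}$ with $1\in\mathcal{R}$ that is complete local and has field of fractions $\mathbb{F}_q((z))$; equivalently, $z^N\mathcal{O}\subset\mathcal{R}$ for some $N$. Its maximal ideal is $\mathfrak{m}=\mathcal{R}\cap z\mathcal{O}$, so that $\mathcal{R}/\mathfrak{m}=\mathbb{F}_q$. A standard module is an $\mathcal{R}$-submodule $M\subset\mathcal{O}$ containing an element of the form $1+z(\cdots)$, $(\cdots)\in\mathcal{O}$. Put $\Delta(M)=\{\nu_z(v)\mid 0\neq v\in M\}$, $\deg(M)=\dim_{\mathbb{F}_q}(\mathcal{O}/M)$, $rk_q(M)=\dim_{\mathbb{F}_q}(M/\mathfrak{m}M)$. For $\ell\ge 0$, a standard $\ell$-flag is a chain $M_0\subset M_1\subset\cdots\subset M_\ell\subset\mathcal{O}$ of $\mathcal{R}$-submodules such that $M_0$ is standard, $\dim_{\mathbb{F}_q}(M_i/M_{i-1})=1$ and $\Delta(M_i)=\Delta(M_{i-1})\cup\{g_i\}$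 (disjoint union) for $1\le i\le\ell$, and $g_1<g_2<\cdots<g_\ell$. The motivic superpolynomial of $\mathcal{R}$ is $$\mathcal{H}^{mot}(q,t,a)=\sum_{\ell\ge0}\ \sum_{\{M_0\subset\cdots\subset M_\ell\}} t^{\deg(M_\ell)}a^\ell ,$$ summed over all standard $\ell$-flags (finitely many); it is a polynomial in the variables $t,a$. *)

(* Defs.v *)
From HB Require Import structures.
From mathcomp Require Import all_boot all_order all_algebra.
From mathcomp Require Import all_classical.

Set Implicit Arguments.
Unset Strict Implicit.
Unset Printing Implicit Defensive.
#[local] Set Warnings "-redundant-canonical-projection".

Import GRing.Theory.

Local Open Scope classical_set_scope.
Local Open Scope ring_scope.

(* F[[z]], with f`[n] the coefficient of z^n.  A dedicated record is used since
   nat -> F already carries the pointwise ring structure. *)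
Record fps (F : Type) := Fps { fcoef : nat -> F }.

Notation "f `[ n ]" := (fcoef f n) (at level 2, n at level 200, left associativity,
  format "f `[ n ]") : ring_scope.

HB.instance Definition _ (F : Type) := gen_eqMixin (fps F).
HB.instance Definition _ (F : Type) := gen_choiceMixin (fps F).

Lemma fpsP (F : Type) (f g : fps F) : (forall n, f`[n] = g`[n]) -> f = g.
Proof. by case: f g => [f] [g] /= fg; congr Fps; apply/funext. Qed.

Section FpsRing.
Variable F : fieldType.
Implicit Types (f g h : fps F) (a b : F).

Definition fps_zero : fps F := Fps (fun=> 0).
Definition fps_opp f := Fps (fun n => - f`[n]).
Definition fps_add f g := Fps (fun n => f`[n] + g`[n]).
Definition fps_one : fps F := Fps (fun n => (n == 0)%:R).
Definition fps_mul f g := Fps (fun n => \sum_(i < n.+1) f`[i] * g`[n - i]).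
Definition fps_scale a f := Fps (fun n => a * f`[n]).

Fact fps_addA : associative fps_add.
Proof. by move=> f g h; apply: fpsP => n /=; rewrite addrA. Qed.
Fact fps_addC : commutative fps_add.
Proof. by move=> f g; apply: fpsP => n /=; rewrite addrC. Qed.
Fact fps_add0 : left_id fps_zero fps_add.
Proof. by move=> f; apply: fpsP => n /=; rewrite add0r. Qed.
Fact fps_addN : left_inverse fps_zero fps_opp fps_add.
Proof. by move=> f; apply: fpsP => n /=; rewrite addNr. Qed.

HB.instance Definition _ :=
  Algebra.isZmodule.Build (fps F) fps_addA fps_addC fps_add0 fps_addN.

Lemma fcoef0 n : (0 : fps F)`[n] = 0. Proof. by []. Qed.
Lemma fcoefD f g n : (f + g)`[n] = f`[n] + g`[n]. Proof. by []. Qed.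
Lemma fcoefN f n : (- f)`[n] = - f`[n]. Proof. by []. Qed.
Lemma fcoefB f g n : (f - g)`[n] = f`[n] - g`[n]. Proof. by []. Qed.
Lemma fcoef_sum (I : Type) (r : seq I) (P : pred I) (E : I -> fps F) n :
  (\sum_(i <- r | P i) E i)`[n] = \sum_(i <- r | P i) (E i)`[n].
Proof. exact: (big_morph (fun f => f`[n]) (fun f g => fcoefD f g n) (fcoef0 n)). Qed.

Let trunc n f : {poly F} := \poly_(i < n) f`[i].

Let coef_fps_mul m n f g :
  (n < m)%N -> (fps_mul f g)`[n] = (trunc m f * trunc m g)`_n.
Proof.
move=> nm; rewrite coefM /=; apply: eq_bigr => -[i /= ile] _.
by rewrite !coef_poly (leq_ltn_trans _ nm) 1?(leq_ltn_trans _ nm) ?leq_subr.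
Qed.

Fact fps_mulC : commutative fps_mul.
Proof.
by move=> f g; apply: fpsP => n; rewrite !(coef_fps_mul _ _ (ltnSn n)) mulrC.
Qed.

Fact fps_mulA : associative fps_mul.
Proof.
have truncM n f g : forall i, (i <= n)%N ->
    (trunc n.+1 (fps_mul f g))`_i = (trunc n.+1 f * trunc n.+1 g)`_i.
  by move=> i lin; rewrite coef_poly ltnS lin (coef_fps_mul _ _ (_ : i < n.+1)%N).
move=> f g h; apply: fpsP => n; rewrite !(coef_fps_mul _ _ (ltnSn n)).
transitivity ((trunc n.+1 f * (trunc n.+1 g * trunc n.+1 h))`_n).
  by rewrite !(coefM (trunc _ f)); apply: eq_bigr => i _; rewrite truncM ?leq_subr.
rewrite mulrA !(coefM _ (trunc _ h)); apply: eq_bigr => i _.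
by rewrite truncM ?(ltnSE (ltn_ord i)).
Qed.

Fact fps_mul1 : left_id fps_one fps_mul.
Proof.
move=> f; apply: fpsP => n /=; rewrite big_ord_recl /= mul1r subn0 big1 ?addr0 //.
by move=> i _; rewrite mul0r.
Qed.

Fact fps_mulD : left_distributive fps_mul fps_add.
Proof.
move=> f g h; apply: fpsP => n /=; rewrite -big_split.
by apply: eq_bigr => i _; rewrite mulrDl.
Qed.

Fact fps_one_neq0 : fps_one != 0.
Proof.
apply/eqP => /(congr1 (fun f => f`[0])) /= /eqP.
by rewrite oner_eq0.
Qed.

HB.instance Definition _ := GRing.Zmodule_isComNzRing.Build (fps F)
  fps_mulA fps_mulC fps_mul1 fps_mulD fps_one_neq0.

Lemma fcoef1 n : (1 : fps F)`[n] = (n == 0)%:R. Proof. by []. Qed.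
Lemma fcoefM f g n : (f * g)`[n] = \sum_(i < n.+1) f`[i] * g`[n - i].
Proof. by []. Qed.

Fact fps_scaleA a b f : fps_scale a (fps_scale b f) = fps_scale (a * b) f.
Proof. by apply: fpsP => n /=; rewrite mulrA. Qed.
Fact fps_scale1 : left_id 1 fps_scale.
Proof. by move=> f; apply: fpsP => n /=; rewrite mul1r. Qed.
Fact fps_scaleDr : right_distributive fps_scale +%R.
Proof. by move=> a f g; apply: fpsP => n /=; rewrite mulrDr. Qed.
Fact fps_scaleDl f : {morph fps_scale^~ f : a b / a + b}.
Proof. by move=> a b; apply: fpsP => n /=; rewrite mulrDl. Qed.

HB.instance Definition _ := GRing.Zmodule_isLmodule.Build F (fps F)
  fps_scaleA fps_scale1 fps_scaleDr fps_scaleDl.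

Lemma fcoefZ a f n : (a *: f)`[n] = a * f`[n]. Proof. by []. Qed.

Fact fps_scaleAl a f g : a *: (f * g) = (a *: f) * g.
Proof.
apply: fpsP => n; rewrite fcoefZ !fcoefM big_distrr.
by apply: eq_bigr => i _ /=; rewrite mulrA.
Qed.

HB.instance Definition _ := GRing.Lmodule_isLalgebra.Build F (fps F) fps_scaleAl.
HB.instance Definition _ := GRing.Lalgebra_isComAlgebra.Build F (fps F).

Definition fps_unit : {pred fps F} := fun f => `[< exists g, g * f = 1 >].
Definition fps_inv f : fps F := xget f [set g | g * f = 1].

Fact fps_mulV : {in fps_unit, left_inverse 1 fps_inv *%R}.
Proof. by move=> f /asboolP fu; exact: (xgetPex f fu). Qed.
Fact fps_unitPl f g : g * f = 1 -> fps_unit f.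
Proof. by move=> fg; apply/asboolP; exists g. Qed.
Fact fps_inv_out : {in [predC fps_unit], fps_inv =1 id}.
Proof.
move=> f /negP fnu; apply: xgetPN => g /= gf1.
by apply: fnu; apply/asboolP; exists g.
Qed.

HB.instance Definition _ := GRing.ComNzRing_hasMulInverse.Build (fps F)
  fps_mulV fps_unitPl fps_inv_out.

Fact fps_integral f g : f * g = 0 -> (f == 0) || (g == 0).
Proof.
move=> fg0; rewrite -[_ || _]negbK negb_or; apply/negP => /andP[f0 g0].
have ex_nz h : h != 0 -> exists n, h`[n] != 0.
  move=> /eqP h0; apply: contra_notP h0 => hz; apply: fpsP => n.
  by apply/eqP; apply: contra_notT hz => hn; exists n.
have [/ex_minnP[m fm mmin] /ex_minnP[n gn nmin]] := (ex_nz f f0, ex_nz g g0).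
have /eqP := congr1 (fun h => h`[m + n]) fg0.
rewrite fcoefM fcoef0 (bigD1 (Ordinal (_ : m < (m + n).+1)%N)) ?ltnS ?leq_addr //=.
move=> mlt; rewrite addKn big1 ?addr0.
  by apply/negP; rewrite mulf_neq0.
move=> i; rewrite -val_eqE /= neq_ltn => /orP[im|mi].
  have [->|/mmin] := eqVneq (f`[i]) 0; first by rewrite mul0r.
  by rewrite leqNgt im.
have [->|/nmin] := eqVneq (g`[m + n - i]) 0; first by rewrite mulr0.
by rewrite leqNgt; case/negP; rewrite ltn_subLR ?ltn_add2r // -ltnS.
Qed.

HB.instance Definition _ := GRing.ComUnitRing_isIntegral.Build (fps F) fps_integral.

End FpsRing.

Definition fpsX (F : fieldType) : fps F := Fps (fun n => (n == 1)%:R).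

(* \nu_z; the value at 0 is junk. *)
Definition fps_val (F : fieldType) (f : fps F) : nat :=
  xget 0%N [set n | f`[n] != 0 /\ forall k, (k < n)%N -> f`[k] = 0].

Section Modules.
Variable F : fieldType.
Local Notation O := (fps F).
Implicit Types R M N I : set O.

(* dim_F (M / N): the size of a family in M that is a basis modulo N; junk
   value 0 when the quotient is infinite-dimensional. *)
Definition quotient_basis M N n (e : 'I_n -> O) :=
  (forall i, M (e i)) /\
  (forall v, M v -> exists! c : {ffun 'I_n -> F}, N (v - \sum_i c i *: e i)).

Definition qdim M N : nat :=
  xget 0%N [set n | exists e : 'I_n -> O, quotient_basis M N e].

Definition subalgebra R :=
  [/\ R 1, forall a x, R x -> R (a *: x),
      forall x y, R x -> R y -> R (x + y) & forall x y, R x -> R y -> R (x * y)].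

Definition submodule R M :=
  [/\ M 0, forall x y, M x -> M y -> M (x + y) & forall r x, R r -> M x -> M (r * x)].

Definition ideal R I := submodule R I /\ I `<=` R.

Definition maximal_ideal R I :=
  [/\ ideal R I, I <> R & forall J, ideal R J -> I `<=` J -> J <> R -> J = I].

Definition is_local R := exists! I, maximal_ideal R I.

Definition fmax R : set O := R `&` [set fpsX F * f | f in setT].

Definition modmul I M : set O :=
  [set x | exists n (a b : 'I_n -> O),
     [/\ forall i, I (a i), forall i, M (b i) & x = \sum_i a i * b i]].

Definition fmaxpow R k : set O := iter k (modmul (fmax R)) R.

(* completeness for the topology defined by the powers of fmax R *)
Definition is_complete R := forall u : nat -> O,
  (forall i, R (u i)) ->
  (forall k, exists n0, forall i j, (n0 <= i)%N -> (n0 <= j)%N ->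
     fmaxpow R k (u i - u j)) ->
  exists2 x, R x & forall k, exists n0, forall i, (n0 <= i)%N ->
     fmaxpow R k (u i - x).

(* {fraction O} is the field F((z)) *)
Definition has_full_fractions R := forall x : {fraction O},
  exists a b, [/\ R a, R b, b != 0 & x = FracField.tofrac a / FracField.tofrac b].

Definition unibranch_ring R :=
  [/\ subalgebra R, is_local R, is_complete R & has_full_fractions R].

Definition standard_module R M :=
  submodule R M /\ exists f, M (1 + fpsX F * f).

Definition valuations M : set nat := [set fps_val v | v in M `\ 0].

Definition fdeg M : nat := qdim setT M.

Definition frk R M : nat := qdim M (modmul (fmax R) M).

Definition standard_flag R l (M : 'I_l.+1 -> set O) :=
  [/\ forall i, submodule R (M i), standard_module R (M ord0) &
    exists g : 'I_l -> nat,
      (forall i j : 'I_l, (i < j)%N -> (g i < g j)%N) /\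
      (forall i : 'I_l,
         let M0 := M (widen_ord (leqnSn l) i) in let M1 := M (lift ord0 i) in
         [/\ M0 `<=` M1, qdim M1 M0 = 1%N, ~ valuations M0 (g i) &
             valuations M1 = valuations M0 `|` [set g i]])].

Definition var_t : {poly {poly int}} := 'X%:P.
Definition var_a : {poly {poly int}} := 'X.

(* The sums are finitely supported: z^N O is contained in R for some N, hence in
   every standard module, and there are finitely many subspaces in between when
   F is finite. *)
Definition motivic_superpolynomial R : {poly {poly int}} :=
  \sum_(l \in [set: nat])
    \sum_(M \in [set M : 'I_l.+1 -> set O | standard_flag R M])
      var_t ^+ fdeg (M ord_max) * var_a ^+ l.

End Modules.

(* Main.v *)
Require Import Defs.
From mathcomp Require Import all_boot all_order all_algebra finmap.
From mathcomp Require Import all_classical.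

(** Write q for the cardinal of F, O for F[[z]], and m for fmax R.

    The ring R contains z^N O for some N ([unibranch_conductor]): its fraction
    field contains z, so R has two elements whose orders are consecutive
    integers, and their monomials realize every large order; a series of large
    order is the limit of partial sums of these monomials, and the partial sums
    converge for the powers of m because the monomials have growing degree.
    Hence standard modules contain z^N O, and everything below happens in a
    finite-dimensional space.

    For a standard module M, let gens(M) be the set of valuations of M that are
    not valuations of m M.  Vectors of M with these orders form a basis of
    M modulo m M ([echelon_basis]), so gens(M) has rk(M) elements, and 0 is the
    smallest one.

    The flags with top module W are counted from the top.  If L is a submodule
    of codimension 1 in W that misses the valuation g of W, then
    - m W is contained in L, so g lies in gens(W) ([cover_modmul]);
    - L is the kernel of a unique linear form coord_g - sum_h c_h coord_h, where
      h runs over the elements of gens(W) below g, so there are q^p such L,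
      where p is the number of these h ([hyper_bij], [fsum_covers]);
    - gens(L) and gens(W) have the same elements below g ([cover_ngens]).
    In a standard flag the next valuation to be removed is below g, and it
    belongs to gens(L) = gens(W) below g.  So the flags of length l with top W
    correspond to the choices of l indices 0 < p_1 < ... < p_l < rk(W), each
    counted q^(p_1 + ... + p_l) times; the index 0 is excluded because removing
    the valuation 0 destroys standardness.  This number is the coefficient of
    a^l in the product of the 1 + q^i a for 0 < i < rk(W) ([fsum_flags]). *)

Set Implicit Arguments.
Unset Strict Implicit.
Unset Printing Implicit Defensive.

Import GRing.Theory.

Local Open Scope classical_set_scope.
Local Open Scope ring_scope.

(** * Orders of power series *)

Section Order.
Variable F : fieldType.
Local Notation O := (fps F).
Implicit Types (f g h u v : O) (M N : set O).

(** The ideal z^k O. *)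
Definition zpow k : set O := [set f | forall i, (i < k)%N -> f`[i] = 0].

(** The nonzero series of valuation n; unlike [fps_val] it excludes 0. *)
Definition ord f n := f`[n] != 0 /\ zpow n f.

Lemma ord_inj f m n : ord f m -> ord f n -> m = n.
Proof.
move=> [fm mf] [fn nf]; case: (ltngtP m n) => // [/nf|/mf] E.
- by rewrite E eqxx in fm.
- by rewrite E eqxx in fn.
Qed.

Lemma ord_neq0 f n : ord f n -> f != 0.
Proof. by move=> [fn _]; apply: contraNneq fn => ->. Qed.

Lemma fps_val_ord f n : ord f n -> fps_val f = n.
Proof. by move=> fn; apply: xget_unique => // m fm; apply: ord_inj fm fn. Qed.

Lemma ord_ex f : f != 0 -> exists n, ord f n.
Proof.
move=> f0; have ex_nz : exists n, f`[n] != 0.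
  apply: contra_neqP f0 => /forallNP fz; apply: fpsP => n.
  by have /negP/negPn/eqP := fz n.
case/ex_minnP: ex_nz => n fn nmin; exists n; split=> // k kn.
by apply/eqP; apply: contraLR kn => /nmin; rewrite -leqNgt.
Qed.

Lemma valuationsP M n : valuations M n <-> exists2 v, M v & ord v n.
Proof.
split=> [[v [Mv /= /eqP v0] <-]|[v Mv vn]].
  by have [m vm] := ord_ex v0; exists v => //; rewrite (fps_val_ord vm).
exists v; last exact: fps_val_ord.
by split=> //=; apply/eqP/(ord_neq0 vn).
Qed.

Lemma valuationsS M N : M `<=` N -> valuations M `<=` valuations N.
Proof. by move=> MN n /valuationsP[v /MN Nv vn]; apply/valuationsP; exists v. Qed.

Definition subspace M := M 0 /\ forall a x y, M x -> M y -> M (a *: x + y).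

Lemma subspaceZ M a x : subspace M -> M x -> M (a *: x).
Proof. by move=> [M0 MD] Mx; rewrite -[_ *: _]addr0; apply: MD. Qed.

Lemma subspaceD M x y : subspace M -> M x -> M y -> M (x + y).
Proof. by move=> [_ MD] Mx My; rewrite -[x]scale1r; apply: MD. Qed.

Lemma subspaceN M x : subspace M -> M x -> M (- x).
Proof. by move=> sM Mx; rewrite -scaleN1r; apply: subspaceZ. Qed.

Lemma subspaceB M x y : subspace M -> M x -> M y -> M (x - y).
Proof. by move=> sM Mx My; apply: subspaceD => //; apply: subspaceN. Qed.

Lemma subspace_sum M (I : Type) (r : seq I) (P : pred I) (E : I -> O) :
  subspace M -> (forall i, P i -> M (E i)) -> M (\sum_(i <- r | P i) E i).
Proof.
move=> sM ME; elim/big_rec: _ => [|i x Pi Mx]; first by case: sM.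
by apply: subspaceD => //; apply: ME.
Qed.

Lemma zpow_subspace k : subspace (zpow k).
Proof.
by split=> [i _|a x y xk yk i ik] //; rewrite fcoefD fcoefZ xk ?yk// mulr0 addr0.
Qed.

Lemma zpow_leq k l f : (k <= l)%N -> zpow l f -> zpow k f.
Proof. by move=> kl lf i ik; apply: lf; apply: leq_trans kl. Qed.

Lemma zpowS k f : zpow k f -> f`[k] = 0 -> zpow k.+1 f.
Proof. by move=> kf fk i; rewrite ltnS leq_eqVlt => /predU1P[->|/kf]. Qed.

Lemma zpow0 f : zpow 0 f. Proof. by []. Qed.

Lemma zpow1 f : zpow 1 f <-> f`[0] = 0.
Proof. by split=> [/(_ 0%N)->//|f0]; apply: zpowS. Qed.

Lemma zpow_all f : (forall k, zpow k f) -> f = 0.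
Proof. by move=> fz; apply: fpsP => n; apply: (fz n.+1). Qed.

Lemma fcoefM_zpow i j f g : zpow i f -> zpow j g ->
  (f * g)`[i + j] = f`[i] * g`[j].
Proof.
move=> fi gj; have ilt : (i < (i + j).+1)%N by rewrite ltnS leq_addr.
rewrite fcoefM (bigD1 (Ordinal ilt)) //= addKn big1 ?addr0 // => k.
rewrite -val_eqE /= neq_ltn => /orP[/fi->|ik]; first by rewrite mul0r.
by rewrite [g`[_]]gj ?mulr0 // ltn_subLR ?ltn_add2r // -ltnS.
Qed.

Lemma zpowM i j f g : zpow i f -> zpow j g -> zpow (i + j) (f * g).
Proof.
move=> fi gj n nij; rewrite fcoefM big1 // => k _.
have [/fi->|ik] := ltnP k i; first by rewrite mul0r.
rewrite [g`[_]]gj ?mulr0 // ltn_subLR -1?ltnS //.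
by apply: leq_trans nij _; rewrite leq_add2r.
Qed.

Lemma ordM i j f g : ord f i -> ord g j -> ord (f * g) (i + j).
Proof.
move=> [fi zf] [gj zg]; split; last exact: zpowM.
by rewrite fcoefM_zpow // mulf_neq0.
Qed.

Lemma ord_one : ord (1 : O) 0.
Proof. by split=> //; rewrite fcoef1 oner_eq0. Qed.

Lemma ordX f i n : ord f i -> ord (f ^+ n) (i * n).
Proof.
move=> fi; elim: n => [|n IHn]; first by rewrite muln0 expr0; exact: ord_one.
by rewrite exprS mulnS; apply: ordM.
Qed.

Lemma ordZ a f n : a != 0 -> ord f n -> ord (a *: f) n.
Proof.
by move=> a0 [fn zf]; split; [rewrite mulf_neq0|apply: subspaceZ (zpow_subspace n) _].
Qed.

Lemma ordD_zpow f g n : ord f n -> zpow n.+1 g -> ord (f + g) n.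
Proof.
move=> [fn zf] zg; split; first by rewrite fcoefD zg ?addr0.
by apply: subspaceD (zpow_subspace n) zf _; apply: zpow_leq zg.
Qed.

Lemma zpow_reduce n v e : zpow n v -> ord e n ->
  zpow n.+1 (v - (v`[n] / e`[n]) *: e).
Proof.
move=> vn [en ze]; apply: zpowS.
  by apply: subspaceB (zpow_subspace n) vn _; apply: subspaceZ (zpow_subspace n) _.
by rewrite fcoefB fcoefZ divfK // subrr.
Qed.

Lemma ord_fpsX : ord (fpsX F) 1.
Proof. by split; [rewrite /= oner_eq0|case]. Qed.

Lemma zpow1P f : zpow 1 f <-> exists h, fpsX F * h = f.
Proof.
split=> [/zpow1 f0|[h <-]]; last first.
  by have [_ zX] := ord_fpsX; apply: (@zpowM 1 0).
exists (Fps (fun n => f`[n.+1])); apply: fpsP => -[|n].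
  by rewrite fcoefM big_ord_recl big_ord0 /= mul0r addr0 f0.
rewrite fcoefM big_ord_recl /= mul0r add0r big_ord_recl /= mul1r subSS subn0.
by rewrite big1 ?addr0 // => i _; rewrite mul0r.
Qed.

(** The inverse of 1 - x is the z-adic limit of the partial sums S n of the
    geometric series: the n-th coefficient is already that of S (n + 1). *)
Lemma fps_geometric x : zpow 1 x -> exists h, h * (1 - x) = 1.
Proof.
move=> x1; have xn n : zpow n (x ^+ n).
  elim: n => [|n IHn]; first exact: zpow0.
  by rewrite exprS -add1n; apply: zpowM.
pose S n := \sum_(i < n) x ^+ i.
pose h := Fps (fun k => (S k.+1)`[k]).
have hS n : zpow n (h - S n).
  move=> k kn; apply/eqP; rewrite fcoefB subr_eq0 /h /=; apply/eqP.
  rewrite -(subnKC kn) /S [X in _ = X`[_]]big_split_ord /=.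
  rewrite [X in _ + X](_ : _ = 0) ?addr0 // fcoef_sum big1 // => i _.
  by apply: xn; rewrite /= addSn ltnS leq_addr.
exists h; apply/eqP; rewrite -subr_eq0; apply/eqP/zpow_all => n.
have -> : h * (1 - x) - 1 = (h - S n) * (1 - x) - x ^+ n.
  have SE : S n * (1 - x) = 1 - x ^+ n.
    by rewrite mulrC -[1 - x]opprB mulNr -subrX1 opprB.
  by rewrite mulrBl SE -addrA -opprD subrK.
apply: subspaceB (zpow_subspace n) _ (xn n).
by rewrite -[n in zpow n]addn0; apply: zpowM.
Qed.

End Order.

(** * The conductor of a unibranch ring *)

Section Modules.
Variable F : fieldType.
Local Notation O := (fps F).
Implicit Types (f g h u v : O) (I M N R : set O).

Lemma modmul_mem I M x y : I x -> M y -> modmul I M (x * y).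
Proof.
move=> Ix My; exists 1%N, (fun=> x), (fun=> y).
by split=> //; rewrite big_ord1.
Qed.

Lemma modmul_subspace I M : subspace M -> subspace (modmul I M).
Proof.
move=> sM; split.
  by exists 0%N, (fun=> 0), (fun=> 0); split=> [[]|[]|]//; rewrite big_ord0.
move=> a _ _ [n [x [y [Ix My ->]]]] [m [x' [y' [Ix' My' ->]]]].
exists (n + m)%N.
exists (fun i => match fintype.split i with inl j => x j | inr j => x' j end).
exists (fun i => match fintype.split i with inl j => a *: y j | inr j => y' j end).
split=> [i|i|]; [by case: fintype.split| |].
  by case: fintype.split => j //; apply: subspaceZ.
rewrite big_split_ord scaler_sumr; congr (_ + _); apply: eq_bigr => i _.
  by rewrite -/(unsplit (inl i)) unsplitK scalerAr.
by rewrite -/(unsplit (inr i)) unsplitK.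
Qed.

Lemma modmul_sub I M N : subspace N ->
  (forall x y, I x -> M y -> N (x * y)) -> modmul I M `<=` N.
Proof.
move=> sN IMN _ [n [x [y [Ix My ->]]]].
by apply: subspace_sum => // i _; apply: IMN.
Qed.

Lemma modmulS I M N : M `<=` N -> modmul I M `<=` modmul I N.
Proof.
by move=> MN _ [n [x [y [Ix My ->]]]]; exists n, x, y; split=> // i; apply: MN.
Qed.

Lemma submodule_subspace R M : subalgebra R -> submodule R M -> subspace M.
Proof.
move=> [R1 RZ _ _] [M0 MD RM]; split=> // a x y Mx My; apply: MD => //.
by rewrite -[x]mul1r scalerAl; apply: RM => //; apply: RZ.
Qed.

Lemma subalgebra_subspace R : subalgebra R -> subspace R.
Proof.
move=> [R1 RZ RD _]; split=> [|a x y Rx Ry].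
  by rewrite -(scale0r 1); apply: RZ.
by apply: RD => //; apply: RZ.
Qed.

Lemma fmaxP R x : fmax R x <-> R x /\ zpow 1 x.
Proof.
split=> [[Rx /= [h _ xh]]|[Rx /zpow1P[h xh]]].
  by split=> //; apply/zpow1P; exists h.
by split=> //=; exists h.
Qed.

Lemma standard_moduleP R M : subalgebra R ->
  standard_module R M <-> submodule R M /\ valuations M 0.
Proof.
move=> sR; split=> [[sM [f Mf]]|[sM /valuationsP[v Mv [v0 _]]]]; split=> //.
  apply/valuationsP; exists (1 + fpsX F * f) => //.
  apply: ordD_zpow; first exact: ord_one.
  by apply/zpow1P; exists f.
have /zpow1P[h hE] : zpow 1 ((v`[0])^-1 *: v - 1).
  by apply/zpow1; rewrite fcoefB fcoefZ mulVf // fcoef1 subrr.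
exists h; rewrite hE addrC subrK; apply: subspaceZ => //.
exact: submodule_subspace sM.
Qed.

(** A standard module contains a unit u of O, and any x in z^N O is (x / u) u
    with x / u in z^N O, hence in R. *)
Lemma zpow_standard R M (N : nat) : zpow (F := F) N `<=` R -> standard_module R M ->
  zpow (F := F) N `<=` M.
Proof.
move=> NR [[_ _ RM] [f Mf]] x Nx.
have zf : zpow 1 (- (fpsX F * f)).
  by apply: (subspaceN (zpow_subspace F 1)); apply/zpow1P; exists f.
have [h] := fps_geometric zf; rewrite opprK => hE.
rewrite -[x]mulr1 -hE mulrA; apply: RM => //; apply: NR.
by rewrite -[N]addn0; apply: zpowM.
Qed.

Lemma zpow_modmul R M (N : nat) : (0 < N)%N -> zpow (F := F) N `<=` R ->
  standard_module R M -> zpow (F := F) N `<=` modmul (fmax R) M.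
Proof.
move=> N0 NR [_ [f Mf]] x Nx.
have zf : zpow 1 (- (fpsX F * f)).
  by apply: (subspaceN (zpow_subspace F 1)); apply/zpow1P; exists f.
have [h] := fps_geometric zf; rewrite opprK => hE.
rewrite -[x]mulr1 -hE mulrA; apply: modmul_mem => //.
have Nxh : zpow N (x * h) by rewrite -[N]addn0; apply: zpowM.
by apply/fmaxP; split; [apply: NR|apply: zpow_leq Nxh].
Qed.

Lemma fmaxpow_subspace R k : subalgebra R -> subspace (fmaxpow R k).
Proof.
by move=> /subalgebra_subspace sR; elim: k => //= k; apply: modmul_subspace.
Qed.

Lemma fmaxpow_leq R k l : subalgebra R -> (k <= l)%N ->
  fmaxpow R l `<=` fmaxpow R k.
Proof.
move=> sR; have S j : fmaxpow R j.+1 `<=` fmaxpow R j.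
  elim: j => [|j IHj] /=; last exact: modmulS.
  apply: modmul_sub; first exact: subalgebra_subspace.
  by case: sR => _ _ _ RM x y /fmaxP[Rx _]; apply: RM.
move=> /subnKC <-; elim: (l - k)%N => [|d IHd]; first by rewrite addn0.
by rewrite addnS => x /S/IHd.
Qed.

(** The topology of the powers of the maximal ideal is finer than the z-adic one,
    so that limits for the former are limits for the latter. *)
Lemma fmaxpow_zpow R k : fmaxpow R k `<=` zpow (F := F) k.
Proof.
elim: k => [|k IHk] //=; apply: modmul_sub; first exact: zpow_subspace.
by move=> x y /fmaxP[_ x1] /IHk yk; rewrite -add1n; apply: zpowM.
Qed.

Lemma fmaxpowMX R a k l x : fmax R a -> fmaxpow R k x ->
  fmaxpow R (l + k) (a ^+ l * x).
Proof.
move=> ma kx; elim: l => [|l IHl]; first by rewrite mul1r.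
by rewrite exprS -mulrA addSn; apply: modmul_mem.
Qed.

(** As z = a / b with a and b in R, the order of a is one more than that of b. *)
Lemma consecutive_orders R : unibranch_ring R -> exists d a b,
  [/\ (0 < d)%N, R a, R b, ord a d.+1 & ord b d].
Proof.
move=> [[_ _ _ RM] _ _ /(_ (FracField.tofrac (fpsX F)))[a [b [Ra Rb b0]]]].
move=> /(congr1 ( *%R^~ (FracField.tofrac b))).
rewrite divfK ?tofrac_eq0 // -tofracM.
move=> /eqP; rewrite tofrac_eq => /eqP aE.
have [n bn] := ord_ex b0.
have an : ord a n.+1 by rewrite -aE -add1n; apply: ordM bn; exact: ord_fpsX.
(* Both orders are shifted by that of a, which makes them positive. *)
exists (n.+1 + n)%N, (a * a), (a * b); split; rewrite ?addSn //; try exact: RM.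
  by rewrite -addSn -addnS; apply: ordM.
by rewrite -addSn; apply: ordM.
Qed.

(** If n = k d + i with i < d and i <= k, the monomial a^i b^(k - i) in the two
    elements of orders d + 1 and d has order n.  Its degree k is what makes the
    successive approximations of [unibranch_conductor] converge inside R. *)
Lemma deep_elements R : unibranch_ring R -> exists d, (0 < d)%N /\
  forall n, (d * d <= n)%N -> exists2 g, ord g n & fmaxpow R (n %/ d) g.
Proof.
move=> uR; have [d [a [b [d0 Ra Rb oa ob]]]] := consecutive_orders uR.
have [[R1 _ _ _] _ _ _] := uR.
exists d; split=> // n dn; pose i := (n %% d)%N; pose k := (n %/ d)%N.
have ik : (i <= k)%N.
  by rewrite ltnW // (leq_trans (ltn_pmod n d0)) // leq_divRL.
exists (a ^+ i * (b ^+ (k - i) * 1)).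
  have -> : n = (d.+1 * i + d * (k - i))%N.
    by rewrite mulSn -addnA -mulnDr subnKC // [RHS]addnC mulnC -divn_eq.
  by rewrite mulr1; apply: ordM; apply: ordX.
have m_of x m : R x -> ord x m.+1 -> fmax R x.
  by move=> Rx [_ xm]; apply/fmaxP; split=> //; apply: zpow_leq xm.
have mb : fmax R b by case: d d0 ob {oa dn i k ik} => // d _; apply: m_of.
have ma : fmax R a := m_of _ _ Ra oa.
by have := fmaxpowMX i ma (fmaxpowMX (k := 0) (k - i) mb R1); rewrite addn0 subnKC.
Qed.

(** A series f of order at least N is approximated by cancelling its lowest
    coefficient again and again with the elements of [deep_elements]; by
    completeness the approximations converge in R, and their limit is f. *)
Theorem unibranch_conductor R : unibranch_ring R ->
  exists2 N : nat, (0 < N)%N & zpow (F := F) N `<=` R.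
Proof.
move=> uR; have [d [d0 gex]] := deep_elements uR; have [sR _ cR _] := uR.
exists (d * d)%N; first by rewrite muln_gt0 d0.
set N := (d * d)%N in gex *; move=> f Nf.
have /choice[g gP] : forall i, exists g,
    ord g (N + i)%N /\ fmaxpow R ((N + i) %/ d) g.
  by move=> i; have [|g] := gex (N + i)%N; [rewrite leq_addr|exists g].
(* r n is what is left of f once the coefficients below N + n are cancelled. *)
pose fix r n := if n is i.+1 then
  r i - ((r i)`[N + i] / (g i)`[N + i]) *: g i else f.
have rz n : zpow (N + n) (r n).
  elim: n => [|n IHn]; first by rewrite addn0.
  by rewrite addnS; apply: zpow_reduce IHn (gP n).1.
pose u n := f - r n.
have u_step n : exists c, u n.+1 - u n = c *: g n.
  by eexists; rewrite /u /= !opprB addrA (addrA f) subrK addrC addKr.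
have u_close k i j : (k * d <= N + i)%N -> fmaxpow R k (u (i + j)%N - u i).
  move=> ki; have sk := fmaxpow_subspace k sR.
  elim: j => [|j IHj]; first by rewrite addn0 subrr; case: sk.
  rewrite addnS -(subrK (u (i + j)%N) (u _)) -addrA.
  apply: subspaceD => //; have [c ->] := u_step (i + j)%N.
  apply: subspaceZ => //; have [_] := gP (i + j)%N; apply: fmaxpow_leq => //.
  by rewrite leq_divRL // (leq_trans ki) // leq_add2l leq_addr.
have uR' i : R (u i).
  elim: i => [|i IHi].
    by rewrite /u subrr; case: (subalgebra_subspace sR).
  rewrite -(subrK (u i) (u _)); have [c ->] := u_step i.
  have sR' := subalgebra_subspace sR; apply: subspaceD => //.
  by apply: subspaceZ => //; have [_] := gP i; apply: (@fmaxpow_leq R 0).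
have [||x Rx xP] := cR u => //.
  move=> k; exists (k * d)%N => i j ki kj.
  wlog ij : i j ki kj / (i <= j)%N => [hw|].
    have [/hw|/ltnW/hw] := leqP i j; first by apply.
    move=> /(_ kj ki); rewrite -opprB.
    by move=> /subspaceN; rewrite opprK; apply; apply: fmaxpow_subspace.
  rewrite -(subnKC ij) -opprB; apply: subspaceN; first exact: fmaxpow_subspace.
  by apply: u_close; apply: leq_trans ki _; rewrite leq_addl.
suff -> : f = x by [].
apply/eqP; rewrite -subr_eq0; apply/eqP/zpow_all => k.
have [n0 nP] := xP k; have kz := zpow_subspace F k.
have -> : f - x = (u (maxn n0 k) - x) + r (maxn n0 k).
  by rewrite /u addrAC subrK.
apply: (subspaceD kz); first by apply: fmaxpow_zpow; apply: nP; rewrite leq_maxl.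
by apply: zpow_leq (rz _); rewrite (leq_trans (leq_maxr n0 k)) // leq_addl.
Qed.

End Modules.

(** * Echelon bases of a quotient *)

Section Gaps.
Variable F : fieldType.
Implicit Types (M N : set (fps F)).

(** For N inside M, the gaps index an echelon basis of M modulo N. *)
Definition gap M N i := valuations M i /\ ~ valuations N i.

Definition ngap M N b := #|[pred i : 'I_b | `[< gap M N i >]]|.

Lemma ngapS M N b : ngap M N b.+1 = (ngap M N b + `[< gap M N b >])%N.
Proof. by rewrite /ngap -!sum1_card big_mkcond big_ord_recr -big_mkcond. Qed.

Lemma eq_ngap M N M' N' b : (forall i, (i < b)%N -> gap M N i <-> gap M' N' i) ->
  ngap M N b = ngap M' N' b.
Proof.
by move=> E; apply: eq_card => i; rewrite !inE; apply: asbool_equiv_eq; apply: E.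
Qed.

Definition lead M i : fps F := xget 0 [set v | M v /\ ord v i].

Lemma leadP M i : valuations M i -> M (lead M i) /\ ord (lead M i) i.
Proof.
move=> /valuationsP[v Mv vi].
by apply: (@xgetPex _ 0 [set v | M v /\ ord v i]); exists v.
Qed.

Lemma valuations_zpow N K i : zpow K `<=` N -> (K <= i)%N -> valuations N i.
Proof.
move=> KN Ki; apply/valuationsP; exists (fpsX F ^+ i).
  by apply: KN; apply: zpow_leq Ki _; have [] := ordX i (ord_fpsX F); rewrite mul1n.
by rewrite -[i in ord _ i]mul1n; apply/ordX/ord_fpsX.
Qed.

Lemma gap_lt M N K i : zpow K `<=` N -> gap M N i -> (i < K)%N.
Proof.
by move=> KN [_ Ni]; rewrite ltnNge; apply/negP => /(valuations_zpow KN).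
Qed.

End Gaps.

Section Echelon.
Variables (F : fieldType) (M N : set (fps F)) (K : nat).
Hypotheses (sM : subspace M) (sN : subspace N) (NM : N `<=` M).
Hypothesis KN : zpow K `<=` N.
Local Notation gap := (gap M N).
Local Notation e := (lead M).
Implicit Types (c d : nat -> F) (v w : fps F).

Definition comb c := \sum_(i < K) c i *: e i.

Definition gap_supported c := forall i, ~ gap i -> c i = 0.

(** The coordinates of v in the basis of M / N formed by the leads at the gaps.
    They are functions on nat that vanish off the gaps, which spares an
    enumeration of the gaps. *)
Definition echelon_coord v : nat -> F :=
  xget (fun=> 0) [set c | gap_supported c /\ N (v - comb c)].

Lemma comb_linear a c d :
  comb (fun i => a * c i + d i) = a *: comb c + comb d.
Proof.
rewrite /comb scaler_sumr -big_split; apply: eq_bigr => i _ /=.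
by rewrite scalerDl scalerA.
Qed.

Lemma comb_delta i a : (i < K)%N -> comb (fun j => a *+ (j == i)) = a *: e i.
Proof.
move=> iK; rewrite /comb (bigD1 (Ordinal iK)) //= eqxx mulr1n big1 ?addr0 // => j.
by rewrite -val_eqE /= => /negPf ->; rewrite mulr0n scale0r.
Qed.

(** Reduction: the lowest coefficient of v is cancelled by an element of N if its
    position is a valuation of N, by a lead otherwise; beyond K everything is
    in N. *)
Lemma echelon_expand k v : M v -> zpow k v -> exists c,
  [/\ gap_supported c, N (v - comb c) & forall i, (i < k)%N -> c i = 0].
Proof.
move=> Mv kv; have [m Km] : exists m, (K <= k + m)%N by exists K; rewrite leq_addl.
elim: m => [|m IHm] in k v Mv kv Km *.
  exists (fun=> 0); split=> //; rewrite /comb big1 ?subr0 => [|i _]; last first.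
    by rewrite scale0r.
  by apply: KN; apply: zpow_leq kv; rewrite addn0 in Km.
have step w : M w -> ord w k ->
    exists a c, [/\ gap_supported c, N (v - a *: w - comb c) &
                    forall i, (i < k.+1)%N -> c i = 0].
  move=> Mw wk; exists (v`[k] / w`[k]); apply: IHm.
  - by apply: subspaceB => //; apply: subspaceZ.
  - exact: zpow_reduce.
  - by rewrite addSnnS.
have [vk|/negP vk] := eqVneq v`[k] 0.
  have [|c [cs cN ck]] := IHm _ _ Mv (zpowS kv vk); first by rewrite addSnnS.
  by exists c; split=> // i ik; apply: ck; rewrite ltnW.
have Vk : valuations M k by apply/valuationsP; exists v => //; split=> //; apply/negP.
have [Nk|Nk] := pselect (valuations N k).
  have /valuationsP[w Nw wk] := Nk.
  have [a [c [cs cN ck]]] := step w (NM Nw) wk.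
  exists c; split=> // [|i ik]; last by apply: ck; rewrite ltnW.
  rewrite -(subrK (a *: w) (v - _)); apply: subspaceD => //.
    by rewrite addrAC.
  exact: subspaceZ.
have gk : gap k by [].
have [Mw wk] := leadP Vk; have [a [c [cs cN ck]]] := step _ Mw wk.
have kK := gap_lt KN gk.
exists (fun i => 1 * (a *+ (i == k)) + c i); split=> [i gi|| i ik].
- rewrite cs // addr0 mul1r; have [ik|//] := eqVneq i k.
  by case: gi; rewrite ik.
- by rewrite comb_linear scale1r comb_delta // opprD addrA.
- by rewrite ck 1?ltnW // (ltn_eqF ik) mulr0n mulr0 addr0.
Qed.

(** The smallest gap with a nonzero coefficient would be the order of the
    combination, hence a valuation of N. *)
Lemma echelon_indep c : gap_supported c -> N (comb c) -> forall i, c i = 0.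
Proof.
move=> cs cN i; apply: contrapT => /eqP ci.
have /ex_minnP[k ck kmin] : exists k, c k != 0 by exists i.
have gk : gap k by apply: contrapT => /cs; apply/eqP.
have kK := gap_lt KN gk; apply: gk.2; apply/valuationsP; exists (comb c) => //.
rewrite /comb (bigD1 (Ordinal kK)) //=; apply: ordD_zpow.
  by apply: ordZ => //; case: (leadP gk.1).
apply: (subspace_sum _ (zpow_subspace F k.+1)) => j.
rewrite -val_eqE /= neq_ltn => /orP[jk|kj].
  have [->|/kmin] := eqVneq (c j) 0; last by rewrite leqNgt jk.
  by rewrite scale0r => ? _.
have [gj|/cs->] := pselect (gap j); last by rewrite scale0r => ? _.
apply: (subspaceZ _ (zpow_subspace F k.+1)).
by have [_ [_]] := leadP gj.1; apply: zpow_leq.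
Qed.

Lemma coordP v : M v -> gap_supported (echelon_coord v) /\ N (v - comb (echelon_coord v)).
Proof.
move=> Mv; have [c [cs cN _]] := echelon_expand Mv (@zpow0 _ v).
pose P := [set c | gap_supported c /\ N (v - comb c)].
by apply: (@xgetPex _ (fun=> 0) P); exists c.
Qed.

Lemma coord_unique v c : M v -> gap_supported c -> N (v - comb c) -> echelon_coord v = c.
Proof.
move=> Mv cs cN; have [ds dN] := coordP Mv; apply/funext => i.
pose d j := (-1) * c j + echelon_coord v j.
suff /(_ i)/eqP : forall j, d j = 0.
  by rewrite /d mulN1r addrC subr_eq0 => /eqP.
apply: echelon_indep => [j gj|]; first by rewrite /d ds // cs // mulr0 addr0.
rewrite comb_linear scaleN1r addrC.
rewrite -[X in X - _](subKr v) addrAC; apply: subspaceB => //.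
Qed.

Lemma coord_linear a v w i : M v -> M w ->
  echelon_coord (a *: v + w) i = a * echelon_coord v i + echelon_coord w i.
Proof.
move=> Mv Mw; have [vs vN] := coordP Mv; have [ws wN] := coordP Mw.
have -> // :
    echelon_coord (a *: v + w) = fun i => a * echelon_coord v i + echelon_coord w i.
apply: coord_unique; first by case: sM => _; apply.
  by move=> j gj; rewrite vs // ws // mulr0 addr0.
rewrite comb_linear opprD addrACA -scalerBr.
by case: sN => _; apply.
Qed.

Lemma coord_eq0P v : M v -> (forall i, echelon_coord v i = 0) <-> N v.
Proof.
move=> Mv; have comb0 : comb (fun=> 0) = 0.
  by rewrite /comb big1 // => i _; rewrite scale0r.
split=> [v0 | Nv i].
  have [_] := coordP Mv; have -> : echelon_coord v = fun=> 0 by apply/funext.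
  by rewrite comb0 subr0.
have -> // : echelon_coord v = fun=> 0.
by apply: coord_unique; rewrite ?comb0 ?subr0.
Qed.

Lemma coord_lead i j : gap j -> echelon_coord (e j) i = (i == j)%:R.
Proof.
move=> gj; have -> // : echelon_coord (e j) = fun i => 1 *+ (i == j).
have [Mej _] := leadP gj.1; apply: coord_unique => //.
  by move=> k gk; case: eqVneq => // kj; case: gk; rewrite kj.
by rewrite comb_delta ?(gap_lt KN gj) // scale1r subrr; case: sN.
Qed.

Lemma coord_zpow k v i : M v -> zpow k v -> (i < k)%N -> echelon_coord v i = 0.
Proof.
move=> Mv kv ik; have [c [cs cN ck]] := echelon_expand Mv kv.
by rewrite (coord_unique Mv cs cN) ck.
Qed.

(** If the coordinate at i vanished, then v minus its expansion would be an
    element of N of order i. *)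
Lemma coord_ord v i : M v -> ord v i -> gap i -> echelon_coord v i != 0.
Proof.
move=> Mv vi gi; apply/eqP => vi0; case: (gi) => _; case.
have [vs vN] := coordP Mv; apply/valuationsP; exists (v - comb (echelon_coord v)) => //.
apply: ordD_zpow => //; rewrite /comb -sumrN.
apply: (subspace_sum _ (zpow_subspace F i.+1)) => j _; rewrite -scalerN.
have [ij|] := ltnP i j.
  have [gj|/vs->] := pselect (gap j); last by rewrite scale0r => ? _.
  apply: (subspaceZ _ (zpow_subspace F i.+1)).
  apply: (subspaceN (zpow_subspace F i.+1)).
  by have [_ [_]] := leadP gj.1; apply: zpow_leq.
rewrite leq_eqVlt => /predU1P[->|ji]; first by rewrite vi0 scale0r => ? _.
by rewrite (coord_zpow Mv vi.2 ji) scale0r => ? _.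
Qed.

Lemma echelon_basis : exists e' : 'I_(ngap M N K) -> fps F, quotient_basis M N e'.
Proof.
pose A := [pred i : 'I_K | `[< gap i >]].
have Agap (j : 'I_#|A|) : gap (enum_val j).
  by have := enum_valP j; rewrite inE.
rewrite /ngap -/A; exists (fun j : 'I_#|A| => e (enum_val j)); split=> [j|v Mv].
  by case: (leadP (Agap j).1).
have combE c : gap_supported c ->
    \sum_(j < #|A|) c (enum_val j) *: e (enum_val j) = comb c.
  move=> cs; rewrite /comb (bigID (mem A)) /= [X in _ + X]big1 ?addr0; last first.
    by move=> i; rewrite inE => /asboolPn/cs->; rewrite scale0r.
  by rewrite [RHS]big_enum_val.
have [vs vN] := coordP Mv.
exists [ffun j : 'I_#|A| => echelon_coord v (enum_val j)]; split.
  by under eq_bigr do rewrite ffunE; rewrite combE.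
move=> c cN; pose d i := \sum_(j : 'I_#|A| | enum_val j == i :> nat) c j.
have dE (j : 'I_#|A|) : d (enum_val j) = c j.
  rewrite /d (bigD1 j) //= big1 ?addr0 // => k /andP[/eqP/val_inj/enum_val_inj->].
  by rewrite eqxx.
have ds : gap_supported d.
  by move=> i gi; rewrite /d big1 // => j /eqP ji; case: gi; rewrite -ji.
have dN : N (v - comb d).
  by rewrite -combE //; under eq_bigr do rewrite dE.
by apply/ffunP => j; rewrite ffunE (coord_unique Mv ds dN) dE.
Qed.

End Echelon.

Section QuotientDimension.
Variable F : finFieldType.
Implicit Types (M N : set (fps F)).

(** Over a finite field the sizes of two bases are compared by counting:
    coordinates give an injection between the spaces of coefficients. *)
Lemma quotient_basis_leq M N m n (e : 'I_m -> fps F) (e' : 'I_n -> fps F) :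
  subspace M -> subspace N ->
  quotient_basis M N e -> quotient_basis M N e' -> (m <= n)%N.
Proof.
move=> sM sN [Me eP] [Me' eP'].
pose s (c : {ffun 'I_m -> F}) := \sum_i c i *: e i.
have Ms c : M (s c) by apply: subspace_sum => // i _; apply: subspaceZ.
have /choice[f fP] : forall c : {ffun 'I_m -> F}, exists d : {ffun 'I_n -> F},
    N (s c - \sum_i d i *: e' i).
  by move=> c; have [d [dN _]] := eP' _ (Ms c); exists d.
have f_inj : injective f.
  move=> c d fcd; have [c' [_ c'u]] := eP _ (Ms c).
  rewrite -(c'u c) ?subrr; last by case: sN.
  apply: c'u; rewrite -/(s d) -[s c](subrK (\sum_i f c i *: e' i)) -addrA.
  apply: subspaceD => //; rewrite fcd -opprB.
  exact: subspaceN.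
have := leq_card f f_inj; rewrite !card_ffun !card_ord leq_exp2l //.
exact: card_finNzRing_gt1.
Qed.

Lemma qdimE M N n (e : 'I_n -> fps F) : subspace M -> subspace N ->
  quotient_basis M N e -> qdim M N = n.
Proof.
move=> sM sN eP; apply: xget_unique; first by exists e.
move=> m [e' eP']; apply/eqP; rewrite eqn_leq.
by rewrite (quotient_basis_leq sM sN eP' eP) (quotient_basis_leq sM sN eP eP').
Qed.

Lemma qdim_ngap M N K : subspace M -> subspace N -> N `<=` M ->
  zpow K `<=` N -> qdim M N = ngap M N K.
Proof.
move=> sM sN NM KN; have [e eP] := echelon_basis sM sN NM KN.
exact: qdimE eP.
Qed.

Lemma qdim1_ex M N : qdim M N = 1%N -> exists2 e, M e &
  forall v, M v -> exists! a : F, N (v - a *: e).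
Proof.
rewrite /qdim; case: xgetP => // n _ [e [Me eP]] n1; subst n.
exists (e ord0) => // v /eP[c [cN cu]]; exists (c ord0); split=> [|a aN].
  by rewrite big_ord1 in cN.
by rewrite (cu [ffun=> a]) ?ffunE // big_ord1 ffunE.
Qed.

Lemma qdim1I M N e : subspace M -> subspace N -> M e ->
  (forall v, M v -> exists! a : F, N (v - a *: e)) -> qdim M N = 1%N.
Proof.
move=> sM sN Me eP; apply: (@qdimE _ _ _ (fun=> e)) => //; split=> // v Mv.
have [a [aN au]] := eP v Mv; exists [ffun=> a]; split=> [|c].
  by rewrite big_ord1 ffunE.
by rewrite big_ord1 => /au ->; apply/ffunP => i; rewrite ffunE [i]ord1.
Qed.

End QuotientDimension.

(** * Submodules of codimension one missing a given valuation *)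

Section Covers.
Variables (F : finFieldType) (R : set (fps F)).
Hypothesis sR : subalgebra R.
Implicit Types (M L : set (fps F)).

(** The relation between consecutive modules of a standard flag. *)
Definition covers L M g :=
  [/\ submodule R L, L `<=` M, qdim M L = 1%N, ~ valuations L g &
      valuations M = valuations L `|` [set g]].

Lemma cover_scale L M g v a : covers L M g -> ord v g -> L (a *: v) -> a = 0.
Proof.
move=> [sL _ _ Lg _] vg Lav; apply/eqP; apply: contra_notT Lg => a0.
by apply/valuationsP; exists (a *: v) => //; apply: ordZ.
Qed.

(** M / L is a line, and v lies outside of L because L misses its order. *)
Lemma cover_complement L M g v w : subspace M -> covers L M g ->
  M v -> ord v g -> M w -> exists a, L (w - a *: v).
Proof.
move=> sM cL Mv vg Mw; have [smL LM /qdim1_ex[e Me eP] _ _] := cL.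
have sL := submodule_subspace sR smL.
have [b [bL _]] := eP v Mv; have [c [cL' _]] := eP w Mw.
have b0 : b != 0.
  apply/eqP => b0; rewrite b0 scale0r subr0 in bL.
  have := cover_scale (a := 1) cL vg; rewrite scale1r => /(_ bL)/eqP.
  by rewrite oner_eq0.
exists (c / b).
have -> : w - (c / b) *: v = (w - c *: e) - (c / b) *: (v - b *: e).
  by rewrite scalerBr scalerA divfK // opprB addrA subrK.
by apply: subspaceB => //; apply: subspaceZ.
Qed.

Lemma cover_ord L M g : covers L M g -> exists2 v, M v & ord v g.
Proof. by move=> [_ _ _ _ E]; apply/valuationsP; rewrite E; right. Qed.

(** Multiplication by an element x of the maximal ideal raises orders, so it
    cannot act on the line M / L by a nonzero scalar. *)
Lemma cover_modmul L M g : submodule R M -> covers L M g ->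
  modmul (fmax R) M `<=` L.
Proof.
move=> smM cL; have sM := submodule_subspace sR smM.
have [smL LM _ _ _] := cL; have sL := submodule_subspace sR smL.
have [v Mv vg] := cover_ord cL.
apply: modmul_sub => // x w /fmaxP[Rx x1] Mw.
have Mxv : M (x * v) by case: smM => _ _; apply.
have [a aL] := cover_complement sM cL Mv vg Mxv.
(* Otherwise x v - a v would be an element of L of order g. *)
have a0 : a = 0.
  apply: contrapT => /eqP a0; have [_ _ _ Lg _] := cL; apply: Lg.
  apply/valuationsP; exists (x * v - a *: v) => //.
  rewrite addrC; apply: ordD_zpow.
    by rewrite -scaleNr; apply: ordZ; rewrite ?oppr_eq0.
  by rewrite -add1n; apply: zpowM => //; case: vg.
have [b bL] := cover_complement sM cL Mv vg Mw.
rewrite -(subrK (b *: v) w) mulrDr; apply: subspaceD => //.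
  by case: smL => _ _; apply.
by rewrite -scalerAr; apply: subspaceZ => //; rewrite a0 scale0r subr0 in aL.
Qed.

(** The orders of a minimal system of generators of M. *)
Definition gens M i := gap M (modmul (fmax R) M) i.

Definition ngens M b := ngap M (modmul (fmax R) M) b.

Lemma cover_gens L M g : submodule R M -> covers L M g -> gens M g.
Proof.
move=> smM cL; have [_ _ _ Lg E] := cL; split; first by rewrite E; right.
by move=> /(valuationsS (cover_modmul smM cL)).
Qed.

(** If v in M has order g then M = L + F v, so every element of m M is congruent
    to one of m L modulo m v, whose elements have order above g.  Hence m M and
    m L have the same valuations below g. *)
Lemma cover_ngens L M g : submodule R M -> covers L M g -> ngens L g = ngens M g.
Proof.
move=> smM cL; have sM := submodule_subspace sR smM.
have [smL LM _ _ E] := cL; have sL := submodule_subspace sR smL.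
have [v Mv vg] := cover_ord cL.
have VE i : (i < g)%N -> valuations L i <-> valuations M i.
  move=> ig; rewrite E; split=> [|[//|ig']]; first by left.
  by rewrite ig' ltnn in ig.
have mE i : (i < g)%N ->
    valuations (modmul (fmax R) L) i <-> valuations (modmul (fmax R) M) i.
  move=> ig; split; first exact/valuationsS/modmulS.
  move=> /valuationsP[y My yi].
  have [z mz zy] : exists2 z, modmul (fmax R) L z & zpow g.+1 (y - z).
    have [n [x [w [mx Mw ->]]]] := My.
    have /choice[a aL] i' : exists a, L (w i' - a *: v).
      exact: cover_complement cL Mv vg (Mw i').
    exists (\sum_i x i * (w i - a i *: v)).
      by exists n, x, (fun i => w i - a i *: v).
    rewrite -sumrB; apply: (subspace_sum _ (zpow_subspace F g.+1)) => j _.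
    rewrite -mulrBr subKr -scalerAr.
    apply: (subspaceZ _ (zpow_subspace F g.+1)); rewrite -add1n.
    by apply: zpowM; [case/fmaxP: (mx j)|case: vg].
  apply/valuationsP; exists z => //; rewrite -(subKr y z).
  apply: ordD_zpow => //; apply: (subspaceN (zpow_subspace F i.+1)).
  by apply: zpow_leq zy; rewrite ltnS ltnW.
by apply: eq_ngap => i ig; rewrite /gap VE // mE.
Qed.

Lemma cover_standard L M g : (0 < g)%N -> standard_module R M -> covers L M g ->
  standard_module R L.
Proof.
move=> g0 /(standard_moduleP _ sR)[smM M0] [smL _ _ _ E].
apply/standard_moduleP => //; split=> //; rewrite E in M0.
by case: M0 => // g0'; rewrite -g0' in g0.
Qed.

Lemma sum_ord_head K g (f : nat -> F) : (g < K)%N ->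
  (forall i, (g < i)%N -> f i = 0) -> \sum_(i < K) f i = \sum_(i < g) f i + f g.
Proof.
move=> gK fz; rewrite -(subnKC gK) big_split_ord big_ord_recr /=.
by rewrite [X in _ + X]big1 ?addr0 // => i _; apply: fz; rewrite addSn ltnS leq_addr.
Qed.

Section Count.
Variables (M : set (fps F)) (K g : nat).
Hypotheses (K0 : (0 < K)%N) (KR : zpow K `<=` R) (stM : standard_module R M).
Local Notation N := (modmul (fmax R) M).
Hypothesis gg : gens M g.
Local Notation e := (lead M).
Local Notation coord := (echelon_coord M N K).

Let smM : submodule R M. Proof. by case: stM. Qed.
Let sM : subspace M. Proof. exact: submodule_subspace smM. Qed.
Let sN : subspace N. Proof. exact: modmul_subspace. Qed.
Let KN : zpow K `<=` N. Proof. exact: zpow_modmul stM. Qed.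
Let NM : N `<=` M.
Proof.
apply: modmul_sub => // x y /fmaxP[Rx _] My.
by case: smM => _ _; apply.
Qed.
Let Meg : M (e g). Proof. by case: (leadP gg.1). Qed.
Let eg : ord (e g) g. Proof. by case: (leadP gg.1). Qed.
Let gK : (g < K)%N. Proof. exact: gap_lt KN gg. Qed.

Implicit Types (c : {ffun 'I_g -> F}) (v : fps F).

(** The linear forms on M / m M that take the value 1 on the lead at g and vanish
    on the leads of higher order. *)
Definition hform c v := coord v g - \sum_(h < g) c h * coord v h.

Definition hyper c : set (fps F) := [set v | M v /\ hform c v = 0].

Let coordL a v w i : M v -> M w ->
  coord (a *: v + w) i = a * coord v i + coord w i.
Proof. exact: coord_linear. Qed.

Lemma hform_linear c a v w : M v -> M w ->
  hform c (a *: v + w) = a * hform c v + hform c w.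
Proof.
move=> Mv Mw; rewrite /hform coordL // mulrBr addrACA; congr (_ + _).
rewrite mulr_sumr -opprD -big_split; congr (- _); apply: eq_bigr => h _ /=.
by rewrite coordL // mulrDr mulrCA.
Qed.

Lemma hform_modmul c v : N v -> hform c v = 0.
Proof.
move=> Nv; have v0 := (coord_eq0P sM sN NM KN (NM Nv)).2 Nv.
by rewrite /hform v0 sub0r big1 ?oppr0 // => h _; rewrite v0 mulr0.
Qed.

Lemma hform_lead c : hform c (e g) = 1.
Proof.
have el i : coord (e g) i = (i == g)%:R by exact: coord_lead.
rewrite /hform el eqxx big1 ?subr0 // => h _.
by rewrite el (ltn_eqF (ltn_ord h)) mulr0.
Qed.

Lemma hyper_subspace c : subspace (hyper c).
Proof.
split=> [|a v w [Mv v0] [Mw w0]].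
  by split; [case: sM|apply: hform_modmul; case: sN].
split; first by case: sM => _; apply.
by rewrite hform_linear // v0 w0 mulr0 addr0.
Qed.

Lemma hyper_submodule c : submodule R (hyper c).
Proof.
have sH := hyper_subspace c; split; first by case: sH.
  by move=> x y; apply: subspaceD.
move=> r v Rr [Mv v0]; have [R1 RZ _ _] := sR.
have -> : r * v = r`[0] *: v + (r - r`[0] *: 1) * v.
  by rewrite mulrBl -scalerAl mul1r addrC subrK.
apply: subspaceD => //; first exact: subspaceZ.
have Nrv : N ((r - r`[0] *: 1) * v).
  apply: modmul_mem => //; apply/fmaxP; split.
    by apply: subspaceB => //; [apply: subalgebra_subspace|apply: RZ].
  by apply/zpow1; rewrite fcoefB fcoefZ mulr1 subrr.
by split; [apply: NM|apply: hform_modmul].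
Qed.

Lemma hyper_sub_lead c v : M v -> hyper c (v - hform c v *: e g).
Proof.
move=> Mv; split; first by apply: subspaceB => //; apply: subspaceZ.
by rewrite addrC -scaleNr hform_linear // hform_lead mulr1 addNr.
Qed.

(** A vector of order g has zero coordinates below g and a nonzero one at g, so
    it is outside of the kernel; a vector of another order can be corrected by a
    multiple of the lead at g, or lies in the kernel, without changing its order. *)
Lemma hyper_cover c : covers (hyper c) M g.
Proof.
have smH := hyper_submodule c; have sH := hyper_subspace c.
have HM : hyper c `<=` M by move=> v [].
split=> //.
- apply: (qdim1I (e := e g)) => // v Mv; exists (hform c v); split.
    exact: hyper_sub_lead.
  move=> a [_]; rewrite addrC -scaleNr hform_linear // hform_lead mulr1.
  by rewrite addrC => /eqP; rewrite subr_eq0 => /eqP.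
- move=> /valuationsP[v [Mv v0] vg]; move: v0.
  rewrite /hform big1 ?subr0 => [v0|h _]; last first.
    by rewrite (coord_zpow sM sN NM KN Mv vg.2) ?mulr0.
  by have /eqP := coord_ord sM sN NM KN Mv vg gg.
apply/seteqP; split=> k; last first.
  by case=> [|->]; [apply: valuationsS|case: gg].
move=> /valuationsP[v Mv vk]; have [kg|gk|->] := ltngtP k g; last by right.
  left; apply/valuationsP; exists (v - hform c v *: e g).
    exact: hyper_sub_lead.
  apply: ordD_zpow => //; rewrite -scaleNr.
  apply: (subspaceZ _ (zpow_subspace F k.+1)).
  by case: eg => _; apply: zpow_leq.
left; apply/valuationsP; exists v => //; split=> //.
have v0 i : (i <= g)%N -> coord v i = 0.
  by move=> ig; apply: (coord_zpow sM sN NM KN Mv vk.2); apply: leq_ltn_trans gk.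
rewrite /hform v0 // sub0r big1 ?oppr0 // => h _.
by rewrite v0 ?mulr0 // ltnW.
Qed.

(** Coefficients off [gens M] multiply zero coordinates; they are set to 0 so
    that the form is determined by the hyperplane. *)
Definition hyper_coefs : {pred {ffun 'I_g -> F}} :=
  pffun_on 0 [pred h : 'I_g | `[< gens M h >]] predT.

Lemma hyper_coefsP c :
  reflect (forall h : 'I_g, ~ gens M h -> c h = 0) (c \in hyper_coefs).
Proof.
apply: (iffP pffun_onP) => [[/supportP cS _] h gh|cS].
  by apply: cS; rewrite inE; apply/asboolP.
split=> //; apply/supportP => h; rewrite inE => gh; apply: cS.
by move/asboolP: gh.
Qed.

(** The forms are separated by their values on e_h + c_h e_g. *)
Lemma hyper_inj c d : c \in hyper_coefs -> d \in hyper_coefs ->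
  hyper c = hyper d -> c = d.
Proof.
move=> /hyper_coefsP cS /hyper_coefsP dS cd; apply/ffunP => h.
have [gh|gh] := pselect (gens M h); last by rewrite cS // dS.
have [Meh _] := leadP gh.1.
have fE b : hform b (c h *: e g + e h) = c h - b h.
  rewrite hform_linear // hform_lead mulr1; congr (_ + _).
  have el i : coord (e h) i = (i == h)%:R by exact: coord_lead.
  rewrite /hform el gtn_eqF // sub0r (bigD1 h) //= el eqxx mulr1 big1 ?addr0 //.
  by move=> i; rewrite el -val_eqE => /negPf ->; rewrite mulr0.
have : hyper c (c h *: e g + e h).
  split; first by apply: subspaceD => //; apply: subspaceZ.
  by rewrite fE subrr.
by rewrite cd => -[_]; rewrite fE => /eqP; rewrite subr_eq0 => /eqP.
Qed.

(** Modulo L each lead e_i is a multiple a_i of e_g, and a_i = 0 for i > g since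
    otherwise e_i - a_i e_g would be an element of L of order g.  So L is the
    kernel of sum_i a_i coord_i, where a_g = 1. *)
Lemma hyper_surj L : covers L M g -> exists2 c, c \in hyper_coefs & hyper c = L.
Proof.
move=> cL; have [smL LM _ Lg _] := cL; have sL := submodule_subspace sR smL.
have NL := cover_modmul smM cL.
have /choice[a aP] i : exists a, (gens M i -> L (e i - a *: e g)) /\
    (~ gens M i -> a = 0).
  have [gi|gi] := pselect (gens M i); last by exists 0.
  have [Mei _] := leadP gi.1.
  by have [b bL] := cover_complement sM cL Meg eg Mei; exists b.
have ag : a g = 1.
  apply/eqP; rewrite eq_sym -subr_eq0; apply/eqP; apply: (cover_scale cL eg).
  by rewrite scalerBl scale1r; apply: (aP g).1.
have a_gt i : (g < i)%N -> a i = 0.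
  move=> gi; have [gei|/(aP i).2//] := pselect (gens M i).
  apply: contrapT => /eqP ai; apply: Lg; apply/valuationsP.
  exists (e i - a i *: e g); first exact: (aP i).1.
  rewrite addrC -scaleNr; apply: ordD_zpow; first by apply: ordZ; rewrite ?oppr_eq0.
  by have [_ [_]] := leadP gei.1; apply: zpow_leq.
exists [ffun h : 'I_g => - a h].
  by apply/hyper_coefsP => h gh; rewrite ffunE (aP h).2 ?oppr0.
set c := [ffun h => _].
have vL v : M v -> L (v - hform c v *: e g).
  move=> Mv; have [vs vN] := coordP sM sN NM KN Mv.
  have -> : hform c v = \sum_(i < K) coord v i * a i.
    rewrite (@sum_ord_head _ g (fun i => coord v i * a i)) => //; last first.
      by move=> i gi; rewrite a_gt ?mulr0.
    rewrite /hform ag mulr1 addrC -sumrN; congr (_ + _); apply: eq_bigr => h _.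
    by rewrite ffunE mulNr opprK mulrC.
  rewrite -[X in L (X - _)](subrK (comb M K (coord v))) -addrA; apply: subspaceD => //.
    exact: NL.
  rewrite /comb scaler_suml -sumrB; apply: subspace_sum => // i _.
  have [gi|/vs->] := pselect (gens M i); last first.
    by rewrite mul0r !scale0r subr0; case: sL.
  by rewrite -scalerA -scalerBr; apply: subspaceZ => //; apply: (aP i).1.
apply/seteqP; split=> v.
  by move=> [Mv v0]; have := vL v Mv; rewrite v0 scale0r subr0.
move=> Lv; have Mv := LM v Lv; split=> //; apply: (cover_scale cL eg).
by rewrite -[X in L X](subKr v); apply: subspaceB => //; apply: vL.
Qed.

Lemma hyper_bij : set_bij [set` hyper_coefs] [set L | covers L M g] hyper.
Proof.
split=> [c _|c d|L /hyper_surj[c cS <-]]; first exact: hyper_cover.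
  by move=> /set_mem + /set_mem; apply: hyper_inj.
by exists c.
Qed.

Lemma fsum_covers (A : nmodType) (x : A) :
  \sum_(L \in [set L | covers L M g]) x = x *+ (#|F| ^ ngens M g).
Proof.
rewrite (reindex_fsbig _ _ _ _ hyper_bij) -(@bigfs _ _ _ _ (index_enum _)).
- by rewrite sumr_const card_pffun_on.
- exact: index_enum_uniq.
- by move=> i _; rewrite mem_index_enum.
Qed.

End Count.

End Covers.

(** * Removing and adding the top of a flag *)

Lemma fsum_fibers (I J : choiceType) (V : nmodType) (A : set I) (B : set J)
    (h : I -> J) (f : I -> V) :
  finite_set A -> finite_set B -> (forall i, A i -> B (h i)) ->
  \sum_(i \in A) f i = \sum_(j \in B) \sum_(i \in A `&` h @^-1` [set j]) f i.
Proof.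
move=> Af Bf AB; under [RHS]eq_fsbigr do rewrite fsbig_mkcondr.
rewrite exchange_fsbig //; apply: eq_fsbigr => i /set_mem Ai.
rewrite (fsbigD1 (h i)) ?ifT ?inE //=; last exact: AB.
rewrite fsbig1 ?addr0 // => j [_ /= jh]; rewrite ifF //; apply/negbTE.
by rewrite notin_setE /= => /esym.
Qed.

Lemma fsum_const (I : choiceType) (V : nmodType) (A : set I) (x : V) :
  finite_set A -> \sum_(i \in A) x = x *+ #|` fset_set A|.
Proof.
by move=> Af; rewrite fsbig_finite // big_const_seq count_predT iter_addr addr0.
Qed.

Section Flags.
Variables (F : finFieldType) (R : set (fps F)).
Hypothesis sR : subalgebra R.
Implicit Types (L W : set (fps F)).

(** The standard flags with top module W all of whose new valuations are below b;
    the bound b records the valuation removed just above W in a longer flag. *)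
Definition flags l b W := [set M : 'I_l.+1 -> set (fps F) |
  [/\ standard_flag R M, M ord_max = W &
      forall n, valuations W n -> ~ valuations (M ord0) n -> (n < b)%N]].

Definition flag_belast l (M : 'I_l.+2 -> set (fps F)) : 'I_l.+1 -> set (fps F) :=
  fun i => M (widen_ord (leqnSn l.+1) i).

Definition flag_rcons l (M : 'I_l.+1 -> set (fps F)) W : 'I_l.+2 -> set (fps F) :=
  fun i => if (i <= l)%N then M (inord i) else W.

Lemma flag_rconsK l M W : flag_belast (@flag_rcons l M W) = M.
Proof.
apply/funext => i; rewrite /flag_belast /flag_rcons /= -ltnS ltn_ord.
by rewrite inord_val.
Qed.

Lemma flag_rcons_max l M W : @flag_rcons l M W ord_max = W.
Proof. by rewrite /flag_rcons /= ltnn. Qed.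

Lemma flag_belastK l (M : 'I_l.+2 -> set (fps F)) :
  flag_rcons (flag_belast M) (M ord_max) = M.
Proof.
apply/funext => i; rewrite /flag_rcons /flag_belast; case: leqP => il.
  by congr M; apply: val_inj; rewrite /= inordK.
congr M; apply: val_inj => /=; apply/eqP; rewrite eqn_leq il.
by rewrite -ltnS ltn_ord.
Qed.

(** Induction along the inclusions of a flag. *)
Lemma ord_succ_ind l (P : 'I_l.+1 -> Prop) : P ord0 ->
  (forall i : 'I_l, P (widen_ord (leqnSn l) i) -> P (lift ord0 i)) -> forall j, P j.
Proof.
move=> P0 PS [j]; elim: j => [|j IHj] jl.
  by rewrite (_ : Ordinal jl = ord0) //; apply: val_inj.
have jl' : (j < l)%N by [].
rewrite (_ : Ordinal jl = lift ord0 (Ordinal jl')); last exact: val_inj.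
apply: PS; rewrite (_ : widen_ord _ _ = Ordinal (ltnW jl)) //; exact: val_inj.
Qed.

Lemma flag_mono l (M : 'I_l.+1 -> set (fps F)) (i j : 'I_l.+1) : standard_flag R M ->
  (i <= j)%N -> M i `<=` M j.
Proof.
move=> [_ _ [g [_ gP]]]; elim/ord_succ_ind: j => [|j IHj].
  by rewrite leqn0 => /eqP i0; rewrite (_ : i = ord0) //; apply: val_inj.
rewrite leq_eqVlt => /orP[/eqP/val_inj-> //|]; rewrite lift0 ltnS => /IHj.
by have [+ _ _ _] := gP j => /[swap]; apply: subset_trans.
Qed.

Lemma flag_standard l (M : 'I_l.+1 -> set (fps F)) j :
  standard_flag R M -> standard_module R (M j).
Proof.
move=> fM; have [smM [_ [f Mf]] _] := fM; split=> //.
by exists f; apply: (flag_mono (i := ord0)) Mf.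
Qed.

Lemma flag_new_valuation l (M : 'I_l.+1 -> set (fps F)) (g : 'I_l -> nat) n j :
  (forall i : 'I_l, valuations (M (lift ord0 i)) =
                    valuations (M (widen_ord (leqnSn l) i)) `|` [set g i]) ->
  valuations (M j) n -> valuations (M ord0) n \/ exists i, n = g i.
Proof.
move=> gP; elim/ord_succ_ind: j => [|i IHi]; first by left.
by rewrite gP => -[/IHi//|->]; right; exists i.
Qed.

Lemma flag_belast_flag l b W M : flags (l := l.+1) b W M -> exists g,
  [/\ (g < b)%N, covers R (flag_belast M ord_max) W g &
      flags g (flag_belast M ord_max) (flag_belast M)].
Proof.
move=> [fM <- Mb]; have [smM stM [g [gi gP]]] := fM.
pose w := widen_ord (leqnSn l).
have gP' i : let M0 := flag_belast M (w i) in let M1 := flag_belast M (lift ord0 i) in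
    [/\ M0 `<=` M1, qdim M1 M0 = 1%N, ~ valuations M0 (g (w i)) &
        valuations M1 = valuations M0 `|` [set g (w i)]].
  have := gP (w i); rewrite /flag_belast /=.
  rewrite (_ : lift ord0 (w i) = widen_ord (leqnSn l.+1) (lift ord0 i)) //.
  exact: val_inj.
have b0 : flag_belast M ord0 = M ord0 by congr M; apply: val_inj.
have fB : standard_flag R (flag_belast M).
  split=> [i||]; first exact: smM; first by rewrite b0.
  by exists (g \o w); split=> [i j ij|i]; [apply: gi|apply: gP'].
have cM : covers R (flag_belast M ord_max) (M ord_max) (g ord_max).
  have [] := gP ord_max; rewrite (_ : lift ord0 ord_max = ord_max); last exact: val_inj.
  by move=> *; split=> //; apply: smM.
exists (g ord_max); split=> //.
  have [_ _ _ Lg E] := cM; apply: Mb; first by rewrite E; right.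
  by rewrite -b0 => /(valuationsS (flag_mono (i := ord0) fB (leq0n ord_max))).
split=> // n Vn Mn.
have VE i : valuations (flag_belast M (lift ord0 i)) =
    valuations (flag_belast M (w i)) `|` [set g (w i)] by case: (gP' i).
have [//|[i ->]] := flag_new_valuation VE Vn.
by apply: gi; apply: (ltn_ord i).
Qed.

Lemma flag_rcons_flag l b g L W M : submodule R W -> (g < b)%N -> covers R L W g ->
  flags (l := l) g L M -> flags b W (flag_rcons M W).
Proof.
move=> smW gb cL [fM ML Mg]; have [smM stM [h [hi hP]]] := fM.
have [smL LW q1 Lg E] := cL.
have rM (i : 'I_l.+2) (j : 'I_l.+1) : i = j :> nat -> flag_rcons M W i = M j.
  move=> ij; rewrite /flag_rcons ij -ltnS ltn_ord; congr M.
  by apply: val_inj; rewrite /= inordK.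
have r0 : flag_rcons M W ord0 = M ord0 by exact: rM.
have M0L : M ord0 `<=` L by rewrite -ML; apply: flag_mono.
split; last 1 first.
- move=> n; rewrite E r0 => -[Vn Mn|-> _ //].
  by apply: ltn_trans gb; apply: Mg.
- split=> [i||]; last 1 first.
  + have hg i : (h i < g)%N.
      have [M01 _ hn hE] := hP i; apply: Mg.
        have iM := flag_mono (j := ord_max) fM (leq_ord (lift ord0 i)).
        rewrite -ML; apply: (valuationsS iM).
        by rewrite hE; right.
      by move=> /(valuationsS (flag_mono (i := ord0) (j := widen_ord _ i) fM (leq0n _))).
    exists (fun i => oapp h g (unlift ord_max i)); split=> [i j|i].
      case: (unliftP ord_max i) => [i' ->|->]; rewrite ?lift_max; last first.
        by move=> lj; have := ltn_ord j; rewrite ltnNge lj.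
      case: (unliftP ord_max j) => [j' ->|->]; rewrite ?lift_max => ij; first exact: hi.
      exact: hg.
    case: (unliftP ord_max i) => [k ->|->]; cbv zeta.
      rewrite (rM _ (widen_ord (leqnSn l) k)); last exact: lift_max.
      rewrite (rM _ (lift ord0 k)); first exact: hP.
      by rewrite !lift0 lift_max.
    rewrite (rM _ ord_max) // (_ : lift ord0 ord_max = ord_max); last exact: val_inj.
    by rewrite flag_rcons_max ML.
  + by rewrite /flag_rcons; case: ifP.
  + by rewrite r0.
- exact: flag_rcons_max.
Qed.

End Flags.

(** * Counting flags *)

Section GapProduct.
Variable A : comNzRingType.
Implicit Types (c : nat -> A) (G : pred nat).

Definition gap_prod c n : {poly A} := \prod_(1 <= i < n) (1 + (c i)%:P * 'X).

Lemma gap_prodS c n : gap_prod c n.+2 = gap_prod c n.+1 * (1 + (c n.+1)%:P * 'X).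
Proof. by rewrite /gap_prod big_nat_recr. Qed.

Lemma gap_prod_coef0 c n : (gap_prod c n)`_0 = 1.
Proof.
rewrite -horner_coef0 horner_prod big1 // => i _.
by rewrite hornerD hornerM hornerX mulr0 hornerC addr0.
Qed.

Lemma size_gap_prod c n : (size (gap_prod c n) <= n.+1)%N.
Proof.
case: n => [|n]; first by rewrite /gap_prod big_geq // size_poly1.
elim: n => [|n IHn]; first by rewrite /gap_prod big_geq // size_poly1.
rewrite gap_prodS (leq_trans (size_polyMleq _ _)) //.
have s2 : (size (1 + (c n.+1)%:P * 'X : {poly A})%R <= 2)%N.
  rewrite (leq_trans (size_polyD _ _)) // geq_max size_poly1 /= mul_polyC.
  by rewrite (leq_trans (size_scale_leq _ _)) // size_polyX.
by have := leq_add IHn s2; rewrite addn2; case: (_ + _)%N.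
Qed.

(** Expand the product by the largest index i whose factor contributes c_i X.
    Here n g is the index of the element g of G, counted from 0. *)
Lemma gap_prod_coefS c G (n : nat -> nat) b l :
  n 0 = 0%N -> (forall g, n g.+1 = (n g + G g)%N) -> G 0 ->
  \sum_(g < b) (if (0 < g)%N && G g then c (n g) * (gap_prod c (n g))`_l else 0) =
  (gap_prod c (n b))`_l.+1.
Proof.
move=> n0 nS G0; have n_gt0 g : (0 < n g.+1)%N.
  by elim: g => [|g IHg]; rewrite nS ?n0 ?G0 // addn_gt0 IHg.
elim: b => [|b IHb]; first by rewrite big_ord0 n0 /gap_prod big_geq // coef1.
rewrite big_ord_recr /= IHb nS; case: b IHb => [|b] _.
  by rewrite G0 n0 /gap_prod !big_geq // coef1 addr0.
have [Gb|_] /= := boolP (G b.+1); last by rewrite addn0 addr0.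
rewrite addn1; case: (n b.+1) (n_gt0 b) => // k _.
by rewrite gap_prodS mulrDr mulr1 coefD mulrCA mul_polyC coefZ coefMX.
Qed.

End GapProduct.

Section Finiteness.
Variables (F : finFieldType) (R : set (fps F)) (K : nat).
Hypotheses (K0 : (0 < K)%N) (KR : zpow K `<=` R).
Implicit Types (M W : set (fps F)).

(** As standard modules contain z^K O, they are determined by the truncations at
    order K of their elements. *)
Definition truncations M : {set {ffun 'I_K -> F}} :=
  [set t : {ffun 'I_K -> F} | `[< exists2 v, M v & forall i : 'I_K, v`[i] = t i >]].

Lemma truncations_inj M W : standard_module R M -> standard_module R W ->
  subspace M -> subspace W -> truncations M = truncations W -> M = W.
Proof.
have sub M' W' : subspace W' -> zpow K `<=` W' ->
    truncations M' = truncations W' -> M' `<=` W'.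
  move=> sW KW MW v Mv; pose t := [ffun i : 'I_K => v`[i]].
  have : t \in truncations M'.
    by rewrite inE; apply/asboolP; exists v => // i; rewrite ffunE.
  rewrite MW inE => /asboolP[w Ww wt]; rewrite -(subrK w v).
  apply: subspaceD => //; apply: KW => i iK.
  by rewrite fcoefB (wt (Ordinal iK)) ffunE subrr.
move=> stM stW sM sW MW; apply/seteqP; split.
  by apply: sub MW => //; apply: zpow_standard stW.
by apply: sub (esym MW) => //; apply: zpow_standard stM.
Qed.

Hypothesis sR : subalgebra R.

Lemma finite_standard : finite_set [set M | standard_module R M].
Proof.
set D := [set M | _]; suff /eq_finite_set <- : (truncations @` D #= D)%card by [].
apply: inj_card_eq => M W /set_mem stM /set_mem stW.
by apply: truncations_inj => //; apply: submodule_subspace sR _; [case: stM|case: stW].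
Qed.

Lemma finite_standard_flags l :
  finite_set [set M : 'I_l.+1 -> set (fps F) | standard_flag R M].
Proof.
pose tr (M : 'I_l.+1 -> set (fps F)) := [ffun i => truncations (M i)].
set D := [set M | _]; suff /eq_finite_set <- : (tr @` D #= D)%card by [].
apply: inj_card_eq => M W /set_mem fM /set_mem fW /ffunP MW; apply/funext => i.
have [sM sW] := (flag_standard i fM, flag_standard i fW).
apply: truncations_inj => //; try by apply: submodule_subspace sR _; [case: sM|case: sW].
- by apply: submodule_subspace sR _; case: sM.
- by apply: submodule_subspace sR _; case: sW.
by have := MW i; rewrite !ffunE.
Qed.

Lemma frk_ngens M : standard_module R M -> frk R M = ngens R M K.
Proof.
move=> stM; have [smM _] := stM; have sM := submodule_subspace sR smM.
apply: qdim_ngap => //; first exact: modmul_subspace.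
  apply: modmul_sub => // x y /fmaxP[Rx _] My.
  by case: smM => _ _; apply.
exact: zpow_modmul stM.
Qed.

End Finiteness.

Section CountFlags.
Variables (F : finFieldType) (R : set (fps F)) (K : nat).
Hypotheses (sR : subalgebra R) (K0 : (0 < K)%N) (KR : zpow K `<=` R).
Variable A : comNzRingType.
Implicit Types (L W : set (fps F)).

Local Notation std := [set M | standard_module R M].
Local Notation q i := ((#|F| ^ i)%:R : A).

Lemma finite_flags l b W : finite_set (flags R b W : set ('I_l.+1 -> set (fps F))).
Proof.
by apply: sub_finite_set (finite_standard_flags KR sR l) => M [].
Qed.

Lemma flags0 b W : standard_module R W ->
  (flags R b W : set ('I_1 -> set (fps F))) = [set fun=> W].
Proof.
move=> stW; apply/seteqP; split=> [M [_ MW _] /=|_ ->].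
  by apply/funext => i; rewrite -MW; congr M; rewrite !ord1.
split=> //; split=> [i||] //; first by case: stW.
by exists (fun=> 0%N); split=> -[].
Qed.

(** At most one g occurs on the right, namely the valuation of W missing in L. *)
Lemma fsum_flags_fiber l b L W (x : A) : standard_module R W ->
  \sum_(M \in (flags R b W : set ('I_l.+2 -> set (fps F))) `&`
                (fun M => flag_belast M ord_max) @^-1` [set L]) x =
  \sum_(g < b) (if `[< covers R L W g >]
                then \sum_(M \in (flags R g L : set ('I_l.+1 -> set (fps F)))) x
                else 0).
Proof.
move=> stW; have [[g [gb cL]]|nL] := pselect (exists g, (g < b)%N /\ covers R L W g).
  have cL_uniq g' : covers R L W g' -> g' = g.
    move=> [_ _ _ Lg' E]; have [_ _ _ _ E'] := cL.
    have : valuations W g' by rewrite E; right.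
    by rewrite E' => -[].
  rewrite (bigD1 (Ordinal gb)) //= asboolT // [X in _ + X]big1 ?addr0; last first.
    move=> i ig; rewrite asboolF // => /cL_uniq ig'.
    by move: ig; rewrite -val_eqE /= ig' eqxx.
  apply: (reindex_fsbig (fun M => flag_rcons M W)); split.
  - move=> M Mf; split; first by apply: flag_rcons_flag Mf => //; case: stW.
    by rewrite /= flag_rconsK; case: Mf.
  - by move=> M M' _ _ /(congr1 (@flag_belast _ _)); rewrite !flag_rconsK.
  - move=> M [Mf /= ML]; have [g' [gb' cg' Mf']] := flag_belast_flag Mf.
    rewrite ML in cg' Mf'; exists (flag_belast M).
      by rewrite -(cL_uniq _ cg').
    by case: Mf => _ <- _; rewrite flag_belastK.
rewrite [RHS]big1 => [|g _]; last first.
  by rewrite asboolF // => cL; apply: nL; exists g.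
rewrite (_ : _ `&` _ = set0) ?fsbig_set0 //; apply/seteqP; split=> // M [Mf /= ML].
have [g [gb cg _]] := flag_belast_flag Mf; rewrite ML in cg.
by apply: nL; exists g.
Qed.

(** Induction on the length, by removing the top module: the count for the lower
    module L depends only on the number of elements of gens(L) = gens(W) below
    g, so that it is the same for all L missing g. *)
Theorem fsum_flags l b W : standard_module R W ->
  \sum_(M \in (flags R b W : set ('I_l.+1 -> set (fps F)))) (1 : A) =
  (gap_prod (fun i => q i) (ngens R W b))`_l.
Proof.
elim: l => [|l IHl] in b W * => stW; first by rewrite flags0 // fsbig_set1 gap_prod_coef0.
have finS := finite_standard KR sR.
have [smW W0] := (standard_moduleP _ sR).1 stW.
rewrite (@fsum_fibers _ _ _ _ std (fun M => flag_belast M ord_max)) //; last 2 first.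
- exact: finite_flags.
- move=> M Mf; have [g [_ _ [fM _ _]]] := flag_belast_flag Mf.
  exact: flag_standard fM.
under eq_fsbigr do rewrite fsum_flags_fiber //.
rewrite fsbig_finite // exchange_big /=.
pose phi g := (gap_prod (fun i => q i) (ngens R W g))`_l.
rewrite -(@gap_prod_coefS _ _ (fun g => `[< gens R W g >]) (ngens R W)); first last.
- apply/asboolP; split=> // /valuationsP[x mx [x0 _]].
  suff /zpow1 xz : zpow 1 x by rewrite xz eqxx in x0.
  apply: modmul_sub mx; first exact: zpow_subspace.
  by move=> y z /fmaxP[_ y1] _; apply: (@zpowM _ 1 0).
- exact: ngapS.
- by apply: eq_card0 => -[].
apply: eq_bigr => g _; rewrite -fsbig_finite //.
have -> : \sum_(L \in std) (if `[< covers R L W g >]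
      then \sum_(M \in (flags R g L : set ('I_l.+1 -> set (fps F)))) (1 : A) else 0) =
    \sum_(L \in [set L | covers R L W g]) (if (0 < g)%N then phi g else 0).
  rewrite fsbig_mkcond [RHS]fsbig_mkcond; apply: eq_fsbigr => L _.
  rewrite /patch; case: asboolP => [cL|ncL]; last first.
    by rewrite if_same [RHS]ifF //; apply/negbTE; rewrite notin_setE.
  rewrite [RHS]ifT ?inE //; have [g0|g0] := posnP g.
    rewrite ifF //; apply/negbTE.
    rewrite notin_setE /= => /(standard_moduleP _ sR)[_ L0].
    by have [_ _ _ + _] := cL; rewrite g0.
  have stL := cover_standard sR g0 stW cL.
  by rewrite ifT ?inE // IHl // /phi (cover_ngens sR smW cL).
have [gg|gg] := asboolP (gens R W g); last first.
  rewrite andbF (_ : mkset _ = set0) ?fsbig_set0 //.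
  by apply/seteqP; split=> // L /= cL; apply: gg; apply: cover_gens cL.
rewrite andbT (fsum_covers sR K0 KR stW gg).
by case: ifP => // _; rewrite ?mul0rn // mulr_natl.
Qed.

End CountFlags.

Theorem theorem5p1 (F : finFieldType) (R : set (fps F)) (hR : unibranch_ring R) :
  motivic_superpolynomial R =
  \sum_(M \in [set M : set (fps F) | standard_module R M])
    var_t ^+ fdeg M * \prod_(1 <= i < frk R M) (1 + (#|F| ^ i)%:R * var_a).
Proof.
have [sR _ _ _] := hR; have [K K0 KR] := unibranch_conductor hR.
have finS := finite_standard KR sR.
pose P M : {poly {poly int}} := gap_prod (fun i => (#|F| ^ i)%:R) (ngens R M K).
pose f l M : {poly {poly int}} := var_t ^+ fdeg M * ((P M)`_l)%:P * var_a ^+ l.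
have sizeP M : (size (P M) <= K.+1)%N.
  rewrite (leq_trans (size_gap_prod _ _)) // ltnS /ngens /ngap.
  by rewrite -[leqRHS]card_ord max_card.
have fE l : \sum_(M \in [set M : 'I_l.+1 -> set (fps F) | standard_flag R M])
      var_t ^+ fdeg (M ord_max) * var_a ^+ l =
    \sum_(W \in [set M | standard_module R M]) f l W.
  have finM := finite_standard_flags KR sR l.
  rewrite (@fsum_fibers _ _ _ _ _ (fun M => M ord_max) _ finM finS).
    apply: eq_fsbigr => W /set_mem stW.
    (* All integers from K on are valuations of M ord0: the bound K is vacuous. *)
    have -> : [set M : 'I_l.+1 -> set (fps F) | standard_flag R M]
        `&` (fun M => M ord_max) @^-1` [set W] = flags R K W.
      apply/seteqP; split=> M; last by case.
      move=> [fM MW]; split=> // n _ Mn; rewrite ltnNge; apply/negP => Kn; apply: Mn.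
      apply: valuations_zpow Kn; apply: zpow_standard KR _.
      exact: flag_standard fM.
    have finf := finite_flags sR KR l K W.
    rewrite (eq_fsbigr (fun=> var_t ^+ fdeg W * var_a ^+ l)); last first.
      by move=> M /set_mem[_ ->].
    rewrite fsum_const // /f -(fsum_flags sR K0 KR _ l K stW) fsum_const //.
    by rewrite polyCMn mulrAC mulr_natr.
  by move=> M fM; apply: flag_standard fM.
rewrite /motivic_superpolynomial; under eq_fsbigr do rewrite fE.
rewrite -(fsbig_widen `I_K.+1) //; last first.
  move=> l [_ /negP]; rewrite -leqNgt => Kl /=; rewrite fsbig1 // => W _.
  by rewrite /f nth_default ?mulr0 ?mul0r // (leq_trans (sizeP W)).
rewrite -(fsbig_ord _ K.+1 (fun l => \sum_(W \in [set M | standard_module R M]) f l W)).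
under eq_bigr do rewrite fsbig_finite //.
rewrite exchange_big /= -fsbig_finite //; apply: eq_fsbigr => W /set_mem stW.
rewrite (frk_ngens K0 KR sR stW) /f.
transitivity (var_t ^+ fdeg W * P W).
  rewrite -[P W in RHS](take_poly_id (m := K.+1)) //.
  rewrite /take_poly poly_def mulr_sumr; apply: eq_bigr => l _.
  by rewrite -mulrA mul_polyC.
rewrite /P /gap_prod; congr (_ * _); apply: eq_bigr => i _.
by rewrite polyC_natr.
Qed.
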